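(* Let $f:\mathbb{R}^d\to\mathbb{R}$ be differentiable with minimum value $f^\ast$ and let $L>0$, $\mu>0$, $\tau\in(0,1]$, $\rho\ge 1$. Assume: (L-smooth) $f(x)-f(y)-\langle\nabla f(y),x-y\rangle\le \frac{L}{2}\|x-y\|^2$ for all $x,y\in\mathbb{R}^d$; (SQC) there is a minimizer $x^\ast$ of $f$ such that $f^\ast\ge f(x)+\frac{1}{\tau}\langle\nabla f(x),x^\ast-x\rangle+\frac{\mu}{2}\|x-x^\ast\|^2$ for all $x\in\mathbb{R}^d$; (SGC) the stochastic gradient oracle satisfies $\mathbb{E}_\xi[\nabla f(x,\xi)]=\nabla f(x)$ and $\mathbb{E}_\xi[\|\nabla f(x,\xi)\|^2]\le\rho\|\nabla f(x)\|^2$ for all $x\in\mathbb{R}^d$. Let $\varepsilon\in(0,1)$ with $\varepsilon\ge(\mu/L)^{1/4}$, and run the continuized Nesterov algorithm (defined in the context) with parameters $\eta'=\frac{(1-\varepsilon)\tau}{\rho}\sqrt{\frac{1}{2(2-\tau)}}\sqrt{\frac{\mu}{L}}$, $\eta=\frac{1}{\rho}\sqrt{\frac{2}{2-\tau}}\sqrt{\frac{\mu}{L}}$, $\gamma'=\frac{1}{\rho}\sqrt{\frac{2-\tau}{2\mu L}}$, $\gamma=\frac{1}{\rho L}$. Then for every $k\in\mathbb{N}$, $$\mathbb{E}\Big[e^{\frac{(1-\varepsilon)\tau}{\rho}\sqrt{\frac{2}{2-\tau}}\sqrt{\frac{\mu}{L}}\,T_k}\big(f(\tilde x_k)-f^\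ast\big)\Big]\le\frac{1}{\varepsilon}\big(f(x_0)-f^\ast+\mu\|x_0-x^\ast\|^2\big).$$
   Context: Stochastic gradients: $(\Xi,\mathcal{P})$ is a probability space and $\nabla f(x,\xi)$, $x\in\mathbb{R}^d$, $\xi\in\Xi$, is a measurable stochastic estimate of $\nabla f(x)$; $\mathbb{E}_\xi$ denotes integration in $\xi\sim\mathcal{P}$. Continuized Nesterov algorithm with parameters $(\eta,\eta',\gamma,\gamma')$, $\eta+\eta'>0$: let $T_0=0$ and let $T_{k+1}-T_k$, $k\ge0$, be i.i.d. exponential random variables with parameter $1$; let $\xi_1,\xi_2,\dots$ be i.i.d. with law $\mathcal{P}$, independent of the $T_k$. Given a deterministic $x_0\in\mathbb{R}^d$, set $\tilde x_0=\tilde z_0=x_0$ and, writing $\Delta_k=T_{k+1}-T_k$, for $k\ge0$: $\tilde y_k=\tilde x_k+\frac{\eta}{\eta+\eta'}\big(1-e^{-(\eta+\eta')\Delta_k}\big)(\tilde z_k-\tilde x_k)$, $\tilde x_{k+1}=\tilde y_k-\gamma\nabla f(\tilde y_k,\xi_{k+1})$, $\tilde z_{k+1}=\tilde z_k+\eta'\frac{1-e^{-(\eta+\eta')\Delta_k}}{\eta'+\eta e^{-(\eta+\eta')\Delta_k}}(\tilde y_k-\tilde z_k)-\gamma'\nabla f(\tilde y_k,\xi_{k+1})$. *)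

(* Defs.v *)
From HB Require Import structures.
From mathcomp Require Import all_boot all_order all_algebra.
From mathcomp Require Import all_classical all_reals all_analysis.
Set Implicit Arguments. Unset Strict Implicit. Unset Printing Implicit Defensive.
Import Order.TTheory GRing.Theory Num.Theory.
Import numFieldNormedType.Exports.
Local Open Scope classical_set_scope.
Local Open Scope ring_scope.

(* Euclidean inner product and squared Euclidean norm on R^d = 'rV[R]_d
   (the default norm on matrices in MathComp-Analysis is the max norm,
   so we define the Euclidean quantities explicitly). *)
Definition dotv {R : realType} {d : nat} (u v : 'rV[R]_d) : R :=
  \sum_(i < d) u ord0 i * v ord0 i.
Definition sqnorm {R : realType} {d : nat} (u : 'rV[R]_d) : R := dotv u u.

(* The point of R^d with coordinates given by a d-tuple (d.-tuple R carries
   the product/coordinate sigma-algebra of MathComp-Analysis, i.e. the Borel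
   sigma-algebra of R^d). *)
Definition rV_of_tuple {R : realType} {d : nat} (t : d.-tuple R) : 'rV[R]_d :=
  \row_(j < d) tnth t j.

Definition mutually_independent {R : realType} {dO dX : measure_display}
  {Om : measurableType dO} {Xi : measurableType dX}
  (P : probability Om R) (Delta : nat -> Om -> R) (xi : nat -> Om -> Xi) : Prop :=
  forall (I J : seq nat) (A : nat -> set R) (B : nat -> set Xi),
    uniq I -> uniq J ->
    (forall i, measurable (A i)) -> (forall j, measurable (B j)) ->
    P ((\bigcap_(i in [set` I]) (Delta i @^-1` A i))
       `&` (\bigcap_(j in [set` J]) (xi j @^-1` B j)))
    = (\big[*%E/1%E]_(i <- I) P (Delta i @^-1` A i)
       * \big[*%E/1%E]_(j <- J) P (xi j @^-1` B j))%E.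

(* Continuized Nesterov iterates (x~_k, z~_k), path-wise.
   D k   stands for Delta_k = T_{k+1} - T_k,
   xs k  stands for xi_{k+1} (the sample used at step k -> k+1). *)
Fixpoint cn_iter {R : realType} {d : nat} {Xi : Type}
  (eta eta' gamma gamma' : R) (gs : 'rV[R]_d -> Xi -> 'rV[R]_d)
  (x0 : 'rV[R]_d) (D : nat -> R) (xs : nat -> Xi) (k : nat)
  : 'rV[R]_d * 'rV[R]_d :=
  match k with
  | 0 => (x0, x0)
  | k'.+1 =>
    let xz := cn_iter eta eta' gamma gamma' gs x0 D xs k' in
    let x := xz.1 in
    let z := xz.2 in
    let e := expR (- (eta + eta') * D k') in
    let y := x + (eta / (eta + eta') * (1 - e)) *: (z - x) in
    let g := gs y (xs k') in
    (y - gamma *: g,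
     z + (eta' * (1 - e) / (eta' + eta * e)) *: (y - z) - gamma' *: g)
  end.

Definition arrival {R : realType} (D : nat -> R) (k : nat) : R :=
  \sum_(i < k) D i.

(* Main.v *)
Require Import Defs.
From HB Require Import structures.
From mathcomp Require Import all_boot all_order all_algebra.
From mathcomp Require Import all_classical all_reals all_analysis.
From mathcomp Require Import measurable_realfun.
From mathcomp Require Import ring lra.
Import Order.TTheory GRing.Theory Num.Theory.
Import numFieldNormedType.Exports.
Set Implicit Arguments.
Unset Strict Implicit.
Local Open Scope classical_set_scope.
Local Open Scope ring_scope.

(* Between two arrivals the iterates follow the linear flow
   x' = eta (z - x), z' = eta' (x - z), and an arrival adds a stochastic gradient
   jump.  Let
     W(x, z) = f x - f^* + b |z - x^*|^2 - a |x - x^*|^2,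
     b = mu / (2 - tau),  a = (1 - eps) mu tau / (2 (2 - tau)).
   The term -a |x - x^*|^2 cancels the cross term <x - x^*, z - x^*> produced by
   the flow, and strong quasi-convexity implies the quadratic growth
   f x - f^* >= mu tau / (2 (2 - tau)) |x - x^*|^2, so W >= eps (f x - f^* ).
   For the given parameters, flow plus mean jump make W decrease at rate c:
   integrating d/dt (e^{(c-1)t} W) against the exponential waiting time gives
   E[e^{c Delta} W(next)] <= W.  The hypothesis eps >= (mu/L)^{1/4} absorbs the
   positive contribution 2 a gamma <grad f x, x - x^*> of the jump to -a |x - x^*|^2.
   Independence of the current state from the next Delta and xi lets this one-step
   inequality be iterated. *)

(** * Chains driven by independent inputs *)
(** Both sides are finite measures in [D]: the joint law restricted to [E], and the joint law scaled
    by [P E]. They agree on measurable rectangles, which are stable under intersection and generate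
    the product sigma-algebra. *)
Lemma joint_indep_event (R : realType) (d0 d1 d2 : measure_display)
  (Om : measurableType d0) (M : measurableType d1) (N : measurableType d2)
  (P : probability Om R) (X : Om -> M) (Y : Om -> N) (E : set Om) :
  measurable_fun setT X -> measurable_fun setT Y -> measurable E ->
  (forall A B, measurable A -> measurable B ->
     P (X @^-1` A `&` Y @^-1` B `&` E) = (P (X @^-1` A `&` Y @^-1` B) * P E)%E) ->
  forall D, measurable D ->
    P ((fun w => (X w, Y w)) @^-1` D `&` E)
    = (P ((fun w => (X w, Y w)) @^-1` D) * P E)%E.
Proof.
move=> mX mY mE XYE D mD.
have mXY : measurable_fun setT (fun w => (X w, Y w)).
  exact: measurable_fun_pair.
have p0 : 0 <= fine (P E) by exact: fine_ge0.
pose mi := isMeasurableFun.Build _ _ _ _ _ mXY.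
pose XY : {mfun Om >-> (M * N)%type} := HB.pack (fun w => (X w, Y w)) mi.
pose m1 : {measure set (M * N) -> \bar R} :=
  measure_function_pushforward__canonical__measure_function_Measure (mrestr P mE) mXY.
pose m2 : {measure set (M * N) -> \bar R} :=
  mscale (NngNum p0) (distribution P XY).
pose C : set (set (M * N)) :=
  [set C | exists2 A, measurable A & exists2 B, measurable B & A `*` B = C].
suff : m1 D = m2 D.
  move=> m12; rewrite -[LHS]/(m1 D) m12.
  by rewrite /m2/= /mscale/= fineK ?fin_num_measure// muleC.
apply: (measure_unique C (fun=> setT)) => //.
- by rewrite measurable_prod_measurableType.
- move=> _ _ [X1 mX1 [X2 mX2 <-]] [Y1 mY1 [Y2 mY2 <-]].
  rewrite -setXI; exists (X1 `&` Y1); first exact: measurableI.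
  by exists (X2 `&` Y2) => //; exact: measurableI.
- by move=> n; exists setT => //; exists setT => //; rewrite setXTT.
- by rewrite bigcup_const.
- move=> _ [A mA [B mB <-]].
  rewrite /m2/= /mscale/= fineK ?fin_num_measure// muleC.
  exact: (XYE A B mA mB).
- move=> n; rewrite /m1 /pushforward/= /mrestr/=.
  rewrite (le_lt_trans (probability_le1 _ _)) ?ltry//.
  by rewrite preimage_setT setTI.
Qed.

(** The joint law of [(X, Y)] is the product of the law of [X] and [nu], by uniqueness of product
    measures; Tonelli then gives the iterated integral. *)
Lemma expectation_indep (R : realType) (d0 d1 d2 : measure_display)
  (Om : measurableType d0) (M : measurableType d1) (N : measurableType d2)
  (P : probability Om R) (nu : probability N R) (X : Om -> M) (Y : Om -> N)
  (g : M * N -> \bar R) :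
  measurable_fun setT X -> measurable_fun setT Y ->
  (forall A B, measurable A -> measurable B ->
     P (X @^-1` A `&` Y @^-1` B) = (P (X @^-1` A) * nu B)%E) ->
  measurable_fun setT g -> (forall p, 0 <= g p)%E ->
  (\int[P]_(w in setT) g (X w, Y w)
   = \int[P]_(w in setT) \int[nu]_(y in setT) g (X w, y))%E.
Proof.
move=> mX mY XY mg g0.
have mXY : measurable_fun setT (fun w => (X w, Y w)).
  exact: measurable_fun_pair.
pose Xm : {mfun Om >-> M} := HB.pack X (isMeasurableFun.Build _ _ _ _ _ mX).
pose XYm : {mfun Om >-> (M * N)%type} :=
  HB.pack (fun w => (X w, Y w)) (isMeasurableFun.Build _ _ _ _ _ mXY).
have -> : (\int[P]_(w in setT) g (X w, Y w)
          = \int[distribution P XYm]_(p in setT) g p)%E.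
  by rewrite (ge0_integral_distribution XYm).
have -> : (\int[P]_(w in setT) \int[nu]_(y in setT) g (X w, y)
          = \int[distribution P Xm]_(x in setT) \int[nu]_(y in setT) g (x, y))%E.
  rewrite (ge0_integral_distribution Xm)//.
    exact: (measurable_fun_fubini_tonelli_F g).
  by move=> x; exact: integral_ge0.
rewrite -(fubini_tonelli1 g)//.
apply: eq_measure_integral => A mA _.
exact/esym/product_measure_unique.
Qed.

(** Cylinder events in the inputs still to be consumed. The two index bounds are separate because a
    step of the chain consumes [Delta n] first and [xi n] afterwards. *)
Definition tail_event {R : realType} {dO dX : measure_display}
  {Om : measurableType dO} {Xi : measurableType dX}
  (Delta : nat -> Om -> R) (xi : nat -> Om -> Xi) (m n : nat) : set (set Om) :=
  [set E | exists I J A B,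
    [/\ uniq I /\ uniq J, (forall i, i \in I -> (m <= i)%N) /\ (forall j, j \in J -> (n <= j)%N),
        (forall i, measurable (A i)) /\ (forall j, measurable (B j))
      & E = (\bigcap_(i in [set` I]) (Delta i @^-1` A i))
            `&` (\bigcap_(j in [set` J]) (xi j @^-1` B j)) ]].

Section tail_events.
Context {R : realType} {dO dX : measure_display}
  {Om : measurableType dO} {Xi : measurableType dX}.
Context (P : probability Om R) (Delta : nat -> Om -> R) (xi : nat -> Om -> Xi).
Hypothesis mDelta : forall n, measurable_fun setT (Delta n).
Hypothesis mxi : forall n, measurable_fun setT (xi n).
Hypothesis indep : mutually_independent P Delta xi.

Lemma tail_eventT m n : tail_event Delta xi m n setT.
Proof.
exists [::], [::], (fun=> setT), (fun=> setT); split => //.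
rewrite (_ : [set` [::]] = set0) ?bigcap_set0 ?setTI//.
by apply/seteqP; split.
Qed.

Lemma measurable_tail_event m n E : tail_event Delta xi m n E -> measurable E.
Proof.
move=> [I [J [A [B [_ _ [mA mB] ->]]]]]; apply: measurableI.
- apply: fin_bigcap_measurable => // i _.
  by rewrite -[X in measurable X]setTI; exact: mDelta.
- apply: fin_bigcap_measurable => // i _.
  by rewrite -[X in measurable X]setTI; exact: mxi.
Qed.

Let set_cons (T : choiceType) (x : T) (s : seq T) :
  [set` x :: s] = x |` [set` s].
Proof.
by apply/seteqP; split => y /=; rewrite inE => /predU1P.
Qed.

(** Every index of [I] exceeds [m], so adding [m] to [I] and overriding [A] there by [C] (the family
    [A']) gives a cylinder again, and its product formula splits off the factor of [Delta m]. *)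
Lemma tail_event_Delta m n E (C : set R) :
  tail_event Delta xi m.+1 n E -> measurable C ->
  tail_event Delta xi m n (Delta m @^-1` C `&` E) /\
  P (Delta m @^-1` C `&` E) = (P (Delta m @^-1` C) * P E)%E.
Proof.
move=> [I [J [A [B [[uI uJ] [mI nJ] [mA mB] ->]]]]] mC.
have mNI : m \notin I by apply/negP => /mI; rewrite ltnn.
pose A' i := if i == m then C else A i.
have mA' i : measurable (A' i) by rewrite /A'; case: ifP.
have A'E i : i \in I -> A' i = A i.
  by rewrite /A'; case: eqP => // -> iI; rewrite iI in mNI.
have EE : Delta m @^-1` C `&` (\bigcap_(i in [set` I]) Delta i @^-1` A i
       `&` \bigcap_(j in [set` J]) xi j @^-1` B j) =
   \bigcap_(i in [set` m :: I]) Delta i @^-1` A' i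
       `&` \bigcap_(j in [set` J]) xi j @^-1` B j.
  rewrite set_cons bigcap_setU1 setIA /A' eqxx; congr (_ `&` _ `&` _).
  by apply: eq_bigcapr => i /= iI; rewrite -/(A' i) A'E.
split.
  exists (m :: I), J, A', B; split => //.
  - by rewrite /= mNI uI.
  - split => // i; rewrite inE => /predU1P[->//|/mI]; exact: ltnW.
rewrite EE !indep//=; last by rewrite mNI uI.
rewrite big_cons {1}/A' eqxx -muleA; congr (_ * (_ * _))%E.
by rewrite !big_seq; apply: eq_bigr => i iI; rewrite A'E.
Qed.

Lemma tail_event_xi m n E (C : set Xi) :
  tail_event Delta xi m n.+1 E -> measurable C ->
  tail_event Delta xi m n (xi n @^-1` C `&` E) /\
  P (xi n @^-1` C `&` E) = (P (xi n @^-1` C) * P E)%E.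
Proof.
move=> [I [J [A [B [[uI uJ] [mI nJ] [mA mB] ->]]]]] mC.
have nNJ : n \notin J by apply/negP => /nJ; rewrite ltnn.
pose B' i := if i == n then C else B i.
have mB' i : measurable (B' i) by rewrite /B'; case: ifP.
have B'E i : i \in J -> B' i = B i.
  by rewrite /B'; case: eqP => // -> iJ; rewrite iJ in nNJ.
have EE : xi n @^-1` C `&` (\bigcap_(i in [set` I]) Delta i @^-1` A i
       `&` \bigcap_(j in [set` J]) xi j @^-1` B j) =
   \bigcap_(i in [set` I]) Delta i @^-1` A i
       `&` \bigcap_(j in [set` n :: J]) xi j @^-1` B' j.
  rewrite set_cons bigcap_setU1 setICA /B' eqxx; congr (_ `&` (_ `&` _)).
  by apply: eq_bigcapr => i /= iJ; rewrite -/(B' i) B'E.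
split.
  exists I, (n :: J), A, B'; split => //.
  - by rewrite /= nNJ uJ.
  - split => // i; rewrite inE => /predU1P[->//|/nJ]; exact: ltnW.
rewrite EE !indep//=; last by rewrite nNJ uJ.
rewrite big_cons {1}/B' eqxx muleCA; congr (_ * (_ * _))%E.
by rewrite !big_seq; apply: eq_bigr => i iJ; rewrite B'E.
Qed.

Definition indep_tail {dM : measure_display} {M : measurableType dM}
  (X : Om -> M) (m n : nat) :=
  forall A E, measurable A -> tail_event Delta xi m n E ->
    P (X @^-1` A `&` E) = (P (X @^-1` A) * P E)%E.

Context {dM : measure_display} {M : measurableType dM}.

Lemma indep_tail_Delta (X : Om -> M) m n C : indep_tail X m n ->
  forall A, measurable A -> measurable C ->
  P (X @^-1` A `&` Delta m @^-1` C) = (P (X @^-1` A) * P (Delta m @^-1` C))%E.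
Proof.
move=> iX A mA mC.
have [tE _] := tail_event_Delta (tail_eventT m.+1 n) mC.
by rewrite setIT in tE; rewrite iX.
Qed.

Lemma indep_tail_xi (X : Om -> M) m n C : indep_tail X m n ->
  forall A, measurable A -> measurable C ->
  P (X @^-1` A `&` xi n @^-1` C) = (P (X @^-1` A) * P (xi n @^-1` C))%E.
Proof.
move=> iX A mA mC.
have [tE _] := tail_event_xi (tail_eventT m n.+1) mC.
by rewrite setIT in tE; rewrite iX.
Qed.

(** [X] is independent of the larger cylinder that joins [Delta m] to [E], and [Delta m] is
    independent of [E]. This gives the product formula on rectangles, hence independence of the pair
    [(X, Delta m)] from [E], which passes to its image under [Phi]. *)
Lemma indep_tail_step_Delta (X : Om -> M) (Phi : M * R -> M) m n :
  measurable_fun setT X -> measurable_fun setT Phi -> indep_tail X m n ->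
  indep_tail (fun w => Phi (X w, Delta m w)) m.+1 n.
Proof.
move=> mX mPhi iX A E mA tE.
have mPA : measurable (Phi @^-1` A).
  by rewrite -[X in measurable X]setTI; exact: mPhi.
apply: (@joint_indep_event _ _ _ _ _ _ _ _ X (Delta m) E _ _ _ _ (Phi @^-1` A)) => //.
  exact: measurable_tail_event tE.
move=> B C mB mC; rewrite -setIA.
have [tE' PE'] := tail_event_Delta tE mC.
by rewrite iX// PE' muleA (indep_tail_Delta iX).
Qed.

Lemma indep_tail_step_xi (X : Om -> M) (Phi : M * Xi -> M) m n :
  measurable_fun setT X -> measurable_fun setT Phi -> indep_tail X m n ->
  indep_tail (fun w => Phi (X w, xi n w)) m n.+1.
Proof.
move=> mX mPhi iX A E mA tE.
have mPA : measurable (Phi @^-1` A).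
  by rewrite -[X in measurable X]setTI; exact: mPhi.
apply: (@joint_indep_event _ _ _ _ _ _ _ _ X (xi n) E _ _ _ _ (Phi @^-1` A)) => //.
  exact: measurable_tail_event tE.
move=> B C mB mC; rewrite -setIA.
have [tE' PE'] := tail_event_xi tE mC.
by rewrite iX// PE' muleA (indep_tail_xi iX).
Qed.

Lemma measurable_chain (Phi : M * R -> M) (Psi : M * Xi -> M)
  (X : nat -> Om -> M) (m0 : M) :
  measurable_fun setT Phi -> measurable_fun setT Psi ->
  X 0 = cst m0 ->
  (forall n w, X n.+1 w = Psi (Phi (X n w, Delta n w), xi n w)) ->
  forall n, measurable_fun setT (X n).
Proof.
move=> mPhi mPsi X0 XS; elim=> [|n mX]; first by rewrite X0; exact: measurable_cst.
have -> : X n.+1 = (fun w => Psi (Phi (X n w, Delta n w), xi n w)).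
  by apply/funext => w; rewrite XS.
apply: measurableT_comp => //; apply: measurable_fun_pair => //.
by apply: measurableT_comp => //; exact: measurable_fun_pair.
Qed.

(** Induction on [n]: integrate out [xi n], then [Delta n], each independent of the state it meets,
    and bound the resulting double integral by the one-step hypothesis at the state [X n w]. *)
Lemma expectation_chain_le (nu : probability R R) (PXi : probability Xi R)
  (Phi : M * R -> M) (Psi : M * Xi -> M) (X : nat -> Om -> M) (m0 : M)
  (h : M -> \bar R) :
  (forall n A, measurable A -> P (Delta n @^-1` A) = nu A) ->
  (forall n B, measurable B -> P (xi n @^-1` B) = PXi B) ->
  measurable_fun setT Phi -> measurable_fun setT Psi ->
  X 0 = cst m0 ->
  (forall n w, X n.+1 w = Psi (Phi (X n w, Delta n w), xi n w)) ->
  measurable_fun setT h -> (forall m, 0 <= h m)%E ->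
  (forall m, \int[nu]_(t in setT) \int[PXi]_(s in setT) h (Psi (Phi (m, t), s))
     <= h m)%E ->
  forall n, (\int[P]_(w in setT) h (X n w) <= h m0)%E.
Proof.
move=> lawD lawxi mPhi mPsi X0 XS mh h0 hstep.
have mX := measurable_chain mPhi mPsi X0 XS.
have mX' n : measurable_fun setT (fun w => Phi (X n w, Delta n w)).
  by apply: measurableT_comp => //; exact: measurable_fun_pair.
(* A constant start is independent of everything, and each half-step advances one of the two
   indices. *)
have iX n : indep_tail (X n) n n.
  elim: n => [|n iX].
    rewrite X0 => A E mA tE; rewrite preimage_cst; case: ifPn => _.
      by rewrite setTI probability_setT mul1e.
    by rewrite set0I measure0 mul0e.
  have -> : X n.+1 = (fun w => Psi (Phi (X n w, Delta n w), xi n w)).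
    by apply/funext => w; rewrite XS.
  apply: (indep_tail_step_xi (X := fun w => Phi (X n w, Delta n w))) => //.
  exact: indep_tail_step_Delta.
pose H m := (\int[PXi]_(s in setT) h (Psi (m, s)))%E.
have mhPsi : measurable_fun setT (fun p => h (Psi p)) by exact: measurableT_comp.
have mH : measurable_fun setT H.
  by apply: (measurable_fun_fubini_tonelli_F (fun p => h (Psi p))).
have H0 m : (0 <= H m)%E by exact: integral_ge0.
elim=> [|n IH].
  rewrite X0 (_ : integral _ _ _ = h m0)//.
  transitivity (h m0 * P setT)%E; first by rewrite -integral_cst.
  by rewrite probability_setT mule1.
apply: le_trans IH.
have mHPhi : measurable_fun setT (fun p => H (Phi p)) by exact: measurableT_comp.
under eq_integral do rewrite XS.
rewrite (expectation_indep (nu := PXi) (X := fun w => Phi (X n w, Delta n w))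
  (Y := xi n) (g := fun p => h (Psi p)))//; last first.
  move=> A B mA mB; rewrite -(lawxi n)//; apply: indep_tail_xi _ mA mB.
  exact: indep_tail_step_Delta (iX n).
rewrite (expectation_indep (nu := nu) (X := X n)
  (Y := Delta n) (g := fun p => H (Phi p)))//; last first.
  move=> A B mA mB; rewrite -(lawD n)//; exact: (indep_tail_Delta (iX n) mA mB).
apply: ge0_le_integral => //.
- by move=> w _; exact: integral_ge0.
- pose K m := (\int[nu]_(t in setT) H (Phi (m, t)))%E.
  apply: (measurableT_comp (f := K)) => //.
  by apply: (measurable_fun_fubini_tonelli_F (fun p => H (Phi p))).
- exact: measurableT_comp.
- by move=> w _; exact: hstep.
Qed.

End tail_events.

(** * Integration against a density and along a decreasing function *)

Section density.
Context {d : measure_display} {T : measurableType d} {R : realType}.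
Variables (nu : probability T R) (mu : {sigma_finite_measure set T -> \bar R}).
Variable p : T -> R.
Hypothesis mp : measurable_fun setT p.
Hypothesis nuE : forall A, measurable A -> nu A = (\int[mu]_(x in A) (p x)%:E)%E.

(** [nu] is absolutely continuous with respect to [mu], and [p] equals the Radon-Nikodym derivative
    almost everywhere because both have the same integral over every measurable set. *)
Lemma integral_density (g : T -> \bar R) :
  measurable_fun setT g -> (forall x, 0 <= g x)%E ->
  (\int[nu]_(x in setT) g x = \int[mu]_(x in setT) (g x * (p x)%:E))%E.
Proof.
move=> mg g0.
have mpE : measurable_fun setT (EFin \o p) by exact/measurable_EFinP.
have numu : nu `<< mu.
  apply/null_content_dominatesP => A mA muA0; rewrite nuE//.
  by apply: null_set_integral => //; exact: measurable_funTS.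
rewrite -(Radon_Nikodym_SigmaFinite.change_of_variables numu g0)//.
have fi := Radon_Nikodym_SigmaFinite.f_integrable numu.
have mf := measurable_int _ fi.
apply: ae_eq_integral => //.
- exact: emeasurable_funM.
- exact: emeasurable_funM.
apply: ae_eqe_mul2l.
apply: integral_ae_eq => // E _ mE.
rewrite -Radon_Nikodym_SigmaFinite.f_integral//; exact: nuE.
Qed.

End density.

Section drift.
Context {R : realType}.
Local Notation mu := (@lebesgue_measure R).

Lemma antiderivative_right (F : R -> R) (a : R) : continuous F ->
  exists Phi : R -> R, forall x : R, a < x -> is_derive x 1 Phi (F x).
Proof.
move=> cF; exists (fun x => (\int[mu]_(t in `[a, x]) F t)%R) => x ax.
have xx1 : x < x + 1 by rewrite ltrDl.
have iF : mu.-integrable `[a, x + 1] (EFin \o F).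
  apply: continuous_compact_integrable; first exact: segment_compact.
  by apply: continuous_subspaceT => y; exact: cF.
have [dP dPE] := @continuous_FTC1_closed R F a x (x + 1) xx1 iF ax (cF x).
by apply: DeriveDef => //; rewrite -derive1E.
Qed.

Variables (F F' : R -> R).
Hypothesis dF : forall t : R, is_derive t 1 F (F' t).
Hypothesis F'_le0 : forall t : R, 0 <= t -> F' t <= 0.

Let cF : continuous F.
Proof.
move=> t; apply: differentiable_continuous; apply/derivable1_diffP.
by have [] := dF t.
Qed.

Lemma nonincreasing_of_is_derive_le0 s t : 0 <= s -> s <= t -> F t <= F s.
Proof.
move=> s0 st.
have [c] := @MVT_segment R F F' s t st (fun x _ => dF x)
  (continuous_subspaceT cF).
rewrite in_itv/= => /andP[sc _] FE.
rewrite -subr_le0 FE mulr_le0_ge0 ?subr_ge0//.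
by apply: F'_le0; exact: le_trans s0 sc.
Qed.

Hypothesis F_ge0 : forall t : R, 0 <= t -> 0 <= F t.

(** Minus the forward difference quotient of [F] with step [1/(n+1)]: nonnegative where [F]
    decreases, with limit [- F']. *)
Let q n t : R := n.+1%:R * (F t - F (t + n.+1%:R^-1)).

Let continuous_q n : continuous (q n).
Proof.
rewrite /q; set h := n.+1%:R^-1; move=> x.
apply: cvgM; first exact: cvg_cst.
apply: cvgB; first exact: cF.
apply: (continuous_comp (f := fun t => t + h)); last exact: cF.
by apply: cvgD; [exact: cvg_id|exact: cvg_cst].
Qed.

(** With [h = 1/(n+1)] the integral telescopes to the mean of [F] over [[0, h]] minus its mean over
    [[N, N + h]]. The first mean is a value of [F] at a nonnegative point, hence at most [F 0]; the
    second is nonnegative. *)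
Lemma integral_difference_quotient_le n N : 0 < N ->
  (\int[mu]_(t in `[0%R, N]) (q n t)%:E <= (F 0)%:E)%E.
Proof.
move=> N0; set h : R := n.+1%:R^-1.
have h0 : 0 < h by rewrite invr_gt0 ltr0n.
(* The base point -1 lies to the left of 0, so that [Phi] has a two-sided derivative at 0 as
   well. *)
have [Phi dPhi] := @antiderivative_right F (-1) cF.
have dPhi0 (x : R) : 0 <= x -> is_derive x 1 Phi (F x).
  by move=> x0; apply: dPhi; rewrite (lt_le_trans _ x0)// ltrN10.
pose Psi t := n.+1%:R * (Phi t - Phi (t + h)).
have dPsi (x : R) : 0 <= x -> is_derive x 1 Psi (q n x).
  move=> x0; have d1 := dPhi0 _ x0.
  have d2 : is_derive (x + h) 1 Phi (F (x + h)).
    by apply: dPhi0; rewrite addr_ge0// ltW.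
  have d3 : is_derive x 1 (Phi \o (fun t => t + h)) (F (x + h) * 1).
    apply: is_derive1_comp.
    by apply: is_derive_eq; rewrite addr0.
  rewrite mulr1 in d3.
  have d4 : is_derive x 1 (Phi - (Phi \o (fun t => t + h))) (F x - F (x + h)).
    exact: is_deriveB.
  exact: (is_deriveZ n.+1%:R).
have cPsi x : 0 <= x -> {for x, continuous Psi}.
  move=> x0; apply: differentiable_continuous; apply/derivable1_diffP.
  by have [] := dPsi _ x0.
rewrite (@continuous_FTC2 _ (q n) Psi)//; last 3 first.
- exact: continuous_subspaceT.
- split.
  + move=> x; rewrite in_itv/= => /andP[x0 _].
    by have [] := dPsi _ (ltW x0).
  + by apply: cvg_at_right_filter; exact: cPsi.
  + by apply: cvg_at_left_filter; apply: cPsi; exact: ltW.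
- move=> x; rewrite in_itv/= => /andP[x0 _].
  by rewrite derive1E; have [_ ->] := dPsi _ (ltW x0).
have mvt a : 0 <= a -> exists2 c, a <= c & Phi (a + h) - Phi a = F c * h.
  move=> a0.
  have [|x|c|c] := @MVT_segment R Phi F a (a + h).
  - by rewrite lerDl ltW.
  - by rewrite in_itv/= => /andP[ax _]; apply: dPhi0; rewrite (le_trans a0)// ltW.
  - apply: derivable_within_continuous => x; rewrite in_itv/= => /andP[ax _].
    by have [] := dPhi0 x (le_trans a0 ax).
  - rewrite in_itv/= => /andP[ac _]; rewrite [X in F c * X]addrAC subrr add0r => ->.
    by exists c.
have [c1 c10 E1] := mvt 0 (lexx _).
have [c2 c2N E2] := mvt N (ltW N0).
rewrite -EFinB lee_fin /Psi.
have -> : n.+1%:R * (Phi N - Phi (N + h)) - n.+1%:R * (Phi 0 - Phi (0 + h))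
    = n.+1%:R * (Phi (0 + h) - Phi 0) - n.+1%:R * (Phi (N + h) - Phi N) by ring.
rewrite E1 E2 ![n.+1%:R * (_ * h)]mulrCA /h divff ?pnatr_eq0// !mulr1.
rewrite lerBlDr (le_trans (nonincreasing_of_is_derive_le0 (lexx 0) c10))//.
by rewrite lerDl F_ge0// (le_trans _ c2N)// ltW.
Qed.

(* [F'] need not be continuous: Fatou's lemma on the difference quotients [q n]
   replaces the fundamental theorem of calculus. *)
Lemma integral_le_of_is_derive (G : R -> \bar R) :
  measurable_fun setT G -> (forall t, 0 <= G t)%E ->
  (forall t : R, 0 <= t -> (G t <= (- F' t)%:E)%E) ->
  (\int[mu]_(t in `[0%R, +oo[) G t <= (F 0)%:E)%E.
Proof.
move=> mG G0 GF'.
(* The cut-off at [n.+1] leaves a bounded interval, where the previous bound applies; each fixed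
   point lies inside it from some [n] on. *)
pose f n : R -> \bar R := (EFin \o q n) \_ (`[0%R, n.+1%:R]%classic : set R).
have mf n : measurable_fun (`[0%R, +oo[%classic : set R) (f n).
  apply: measurable_funTS; apply/(measurable_restrictT _ _).1 => //.
  apply/measurable_EFinP; apply: measurable_funTS.
  by apply: continuous_measurable_fun; exact: continuous_q.
have f0 n x : `[0%R, +oo[%classic x -> (0 <= f n x)%E.
  rewrite /= in_itv/= andbT => x0; rewrite /f patchE; case: ifP => // _.
  rewrite lee_fin mulr_ge0// subr_ge0 nonincreasing_of_is_derive_le0//.
  by rewrite lerDl.
have cvf x : 0 <= x -> f ^~ x @ \oo --> (- F' x)%:E.
  move=> x0.
  have [dx dxE] := dF x.
  apply: cvg_trans (_ : (fun n => (q n x)%:E) @ \oo --> _).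
    apply: near_eq_cvg; near=> n; rewrite /f patchE mem_set//= in_itv/= x0/=.
    near: n; exists (Num.truncn x).+1 => // n /= xn.
    by rewrite (le_trans (ltW (Num.Theory.truncnS_gt x)))// ler_nat ltnW.
  apply: cvg_EFin; first by near=> n.
  have Hc : (fun h : R => h^-1 *: ((F \o shift x) (h *: 1) - F x)) @ 0^' --> F' x.
    by rewrite -dxE; exact: dx.
  have Hn : (fun n => n.+1%:R^-1 : R) @ \oo --> 0^'.
    move=> A A0; have [N _ HN] := @cvg_harmonic R _ A0.
    by exists N => // n Nn; apply: (HN n Nn); rewrite gt_eqF ?harmonic_gt0.
  rewrite (_ : _ \o _ = - ((fun h : R => h^-1 *: ((F \o shift x) (h *: 1) - F x))
      \o (fun n => n.+1%:R^-1))); first exact: cvgN (cvg_comp _ _ Hn Hc).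
  apply/funext => n; rewrite /= /q !fctE /= invrK [(_^-1 *: 1)]mulr1 addrC.
  by rewrite -scalerN opprB [in RHS]addrC [n.+1%:R^-1 + x]addrC.
apply: (@le_trans _ _ (\int[mu]_(t in `[0%R, +oo[) limn_einf (f ^~ t)))%E.
  apply: ge0_le_integral => //.
  - exact: measurable_funTS.
  - apply: (emeasurable_fun_cvg f) => // t /=; rewrite in_itv/= andbT => t0.
    by rewrite (cvg_limn_einf_sup (cvf t t0)).1; exact: cvf.
  - move=> t /=; rewrite in_itv/= andbT => t0.
    by rewrite (cvg_limn_einf_sup (cvf t t0)).1; exact: GF'.
apply: (le_trans (fatou _ _ _ _)) => //.
rewrite limn_einf_lim.
apply: lime_le; first exact: is_cvg_einfs.
near=> n; apply: ge_ereal_inf; exists (\int[mu]_(x in `[0%R, +oo[) f n x)%E.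
  by exists n => //=.
rewrite /f -integral_mkcondr setIidr; last first.
  by move=> t /=; rewrite !in_itv/= => /andP[->].
exact: integral_difference_quotient_le.
Unshelve. all: by end_near.
Qed.

End drift.

(** * Vectors of R^d *)

Section tuples.
Context {R : realType} {d : nat}.

(** Rounding the coordinates down to multiples of [1/(n+1)] gives a map with countably many values,
    each taken on a measurable box. So [f] of the rounded point is measurable, and by continuity it
    converges to [f]. *)
Lemma measurable_continuous_rV_of_tuple (f : 'rV[R]_d -> R) : continuous f ->
  measurable_fun setT (fun t : d.-tuple R => f (rV_of_tuple t)).
Proof.
move=> cf.
pose grid n (v : 'rV[int]_d) : 'rV[R]_d := \row_j ((v ord0 j)%:~R / n.+1%:R).
pose rnd n (t : d.-tuple R) : 'rV[int]_d :=
  \row_j Num.floor (tnth t j * n.+1%:R).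
have mrnd n v : measurable [set t | rnd n t = v].
  have -> : [set t | rnd n t = v] = \bigcap_(j in [set` enum 'I_d])
      ((fun t : d.-tuple R => tnth t j * n.+1%:R) @^-1`
        `[(v ord0 j)%:~R, (v ord0 j + 1)%:~R[%classic).
    apply/seteqP; split => t /=.
      by move=> <- j _ /=; rewrite in_itv/= !mxE floor_itv.
    move=> tv; apply/rowP => j; rewrite mxE; apply: floor_def.
    by have := tv j; rewrite /= in_itv/= mem_enum; apply.
  apply: fin_bigcap_measurable => // j _.
  rewrite -[X in measurable X]setTI; apply: measurable_funM => //.
  exact: measurable_tnth.
apply: (measurable_fun_cvg (h := fun n t => f (grid n (rnd n t)))).
  move=> n _ A mA; rewrite setTI.
  have -> : (fun t => f (grid n (rnd n t))) @^-1` A = \bigcup_k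
      (if unpickle k is Some v then
         if f (grid n v) \in A then [set t | rnd n t = v] else set0
       else set0).
    apply/seteqP; split => t /=.
      move=> At; exists (pickle (rnd n t)) => //=.
      by rewrite pickleK mem_set.
    by move=> [k _]; case: unpickle => // v; case: ifPn => // /set_mem /[swap] /= ->.
  apply: bigcupT_measurable => k; case: unpickle => // v.
  by case: ifPn.
move=> t _; apply: (cvg_comp (fun n => grid n (rnd n t)) f); last exact: cf.
apply/cvg_ballP => e e0; near=> n.
split => // i j; rewrite !mxE /ball/=.
have n0 : 0 < n.+1%:R :> R by rewrite ltr0n.
have /andP[] := floor_itv (tnth t j * n.+1%:R).
rewrite -ler_pdivrMr// => h1; rewrite -ltr_pdivlMr// => h2.
rewrite ger0_norm ?subr_ge0// ltrBlDr (lt_trans h2)//.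
rewrite rmorphD/= mulrDl addrC ltrD2r mul1r invf_plt ?posrE//.
rewrite (lt_le_trans (truncnS_gt _))// ler_nat ltnS.
by near: n; exists (Num.truncn e^-1) => // m.
Unshelve. all: by end_near. Qed.

Definition tuple_of_rV (v : 'rV[R]_d) : d.-tuple R := [tuple v ord0 i | i < d].

Lemma tuple_of_rVK (v : 'rV[R]_d) : rV_of_tuple (tuple_of_rV v) = v.
Proof. by apply/rowP => j; rewrite mxE tnth_mktuple. Qed.

Lemma measurable_tuple_of_rV {d0} {T : measurableType d0} (g : T -> 'rV[R]_d) :
  (forall i, measurable_fun setT (fun x => g x ord0 i)) ->
  measurable_fun setT (fun x => tuple_of_rV (g x)).
Proof.
move=> mg; apply/measurable_fun_tnthP => i.
rewrite (_ : _ \o _ = fun x => g x ord0 i)//.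
by apply/funext => x; rewrite /= tnth_mktuple.
Qed.

End tuples.

Section euclidean.
Context {R : realType} {d : nat}.
Implicit Types (u v w : 'rV[R]_d) (a : R).

Lemma dotvC u v : dotv u v = dotv v u.
Proof. by apply: eq_bigr => i _; rewrite mulrC. Qed.

Lemma dotvDl u v w : dotv (u + v) w = dotv u w + dotv v w.
Proof. by rewrite /dotv -big_split/=; apply: eq_bigr => i _; rewrite mxE mulrDl. Qed.

Lemma dotvZl a u w : dotv (a *: u) w = a * dotv u w.
Proof. by rewrite /dotv mulr_sumr; apply: eq_bigr => i _; rewrite mxE mulrA. Qed.

Lemma dotvNl u w : dotv (- u) w = - dotv u w.
Proof. by rewrite -scaleN1r dotvZl mulN1r. Qed.

Lemma dotvDr u v w : dotv w (u + v) = dotv w u + dotv w v.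
Proof. by rewrite ![dotv w _]dotvC dotvDl. Qed.

Lemma dotvZr a u w : dotv w (a *: u) = a * dotv w u.
Proof. by rewrite ![dotv w _]dotvC dotvZl. Qed.

Lemma dotvNr u w : dotv w (- u) = - dotv w u.
Proof. by rewrite ![dotv w _]dotvC dotvNl. Qed.

Definition dotvE := (dotvDl, dotvDr, dotvNl, dotvNr, dotvZl, dotvZr).

Lemma sqnorm_ge0 u : 0 <= sqnorm u.
Proof. by apply: sumr_ge0 => i _; rewrite -expr2 sqr_ge0. Qed.

Lemma sqnormD u v : sqnorm (u + v) = sqnorm u + 2 * dotv u v + sqnorm v.
Proof. by rewrite /sqnorm !dotvE [dotv v u]dotvC; ring. Qed.

Lemma sqnormZ a u : sqnorm (a *: u) = a ^+ 2 * sqnorm u.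
Proof. by rewrite /sqnorm !dotvE mulrA expr2. Qed.

Lemma sqnormB u v : sqnorm (u - v) = sqnorm u - 2 * dotv u v + sqnorm v.
Proof. by rewrite /sqnorm !dotvE [dotv v u]dotvC; ring. Qed.

Lemma sqnormN u : sqnorm (- u) = sqnorm u.
Proof. by rewrite /sqnorm !dotvE opprK. Qed.

Lemma measurable_sqnorm_rV_of_tuple_sub w :
  measurable_fun setT (fun t : d.-tuple R => sqnorm (rV_of_tuple t - w)).
Proof.
rewrite /sqnorm /dotv; apply: measurable_sum => i.
under eq_fun do rewrite !mxE.
by apply: measurable_funM; apply: measurable_funB => //; exact: measurable_tnth.
Qed.

End euclidean.

(** * The Lyapunov function *)

Section quasi_convexity.
Context {R : realType} {d : nat}.
Variables (f : 'rV[R]_d -> R) (grad : 'rV[R]_d -> 'rV[R]_d).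
Variables (xstar : 'rV[R]_d) (fstar mu tau : R).
Hypothesis df : forall x, differentiable f x.
Hypothesis gradE : forall x h, 'd f x h = dotv (grad x) h.
Hypothesis fminE : fstar = f xstar.
Hypothesis fmin : forall x, f xstar <= f x.
Hypotheses (mu0 : 0 < mu) (tau01 : 0 < tau <= 1).
Hypothesis sqc : forall x, f x + tau^-1 * dotv (grad x) (xstar - x)
  + mu / 2 * sqnorm (x - xstar) <= fstar.

Lemma is_derive_line (x w : 'rV[R]_d) (s : R) :
  is_derive s 1 (fun s => f (x + s *: w)) (dotv (grad (x + s *: w)) w).
Proof.
have dfs : derivable f (x + s *: w) w by exact: diff_derivable.
have E : (fun h : R => h^-1 *: (((fun s => f (x + s *: w)) \o shift s) (h *: 1)
             - f (x + s *: w)))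
       = (fun h => h^-1 *: ((f \o shift (x + s *: w)) (h *: w) - f (x + s *: w))).
  apply/funext => h; congr (_ *: (f _ - _)).
  by rewrite /= [h *: 1]mulr1 scalerDl addrCA.
apply: DeriveDef; first by rewrite /derivable E.
by rewrite /derive E -gradE -deriveE.
Qed.

Lemma dotv_grad_ge x :
  tau * (f x - fstar + mu / 2 * sqnorm (x - xstar)) <= dotv (grad x) (x - xstar).
Proof.
have /andP[t0 _] := tau01.
rewrite -ler_pdivlMl//; have := sqc x.
by rewrite -opprB dotvNr; lra.
Qed.

(** On the segment from [xstar] to [x], [dotv_grad_ge] bounds [s phi'(s)] below by
    [tau (phi(s) + mu/2 s^2 |u|^2)], which makes [s^(-tau) phi(s) - kap s^(2-tau) |u|^2]
    nondecreasing in [s]. Its value at 1 is the difference of the two sides of the claim, and its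
    lower limit at 0 is nonnegative since [phi >= 0]. *)
Lemma quadratic_growth x :
  tau * mu / (2 * (2 - tau)) * sqnorm (x - xstar) <= f x - fstar.
Proof.
have /andP[t0 t1] := tau01.
set u := x - xstar; set kap := tau * mu / (2 * (2 - tau)).
have t2 : 0 < 2 - tau by lra.
have kap0 : 0 <= kap by rewrite divr_ge0// mulr_ge0// ltW.
have kapE : kap * (2 - tau) = tau * mu / 2 by rewrite /kap; field; lra.
pose phi s := f (xstar + s *: u) - fstar.
pose dphi s := dotv (grad (xstar + s *: u)) u.
(* chi (- ln s) = s^(-tau) phi s - kap s^(2 - tau) |u|^2 is nondecreasing in s *)
pose chi t := expR (tau * t) * phi (expR (- t))
  - kap * sqnorm u * expR (- (2 - tau) * t).
pose dchi t := expR (tau * t) * (tau * phi (expR (- t)) - expR (- t) * dphi (expR (- t)))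
  + kap * sqnorm u * (2 - tau) * expR (- (2 - tau) * t).
have dchiP (t : R) : is_derive t 1 chi (dchi t).
  have d1 : is_derive (expR (- t)) 1 phi (dphi (expR (- t))).
    have := is_derive_line xstar u (expR (- t)) => ?.
    by apply: is_derive_eq; rewrite subr0.
  have d2 : is_derive t 1 (fun t => expR (- t)) (- expR (- t)).
    by apply: is_derive_eq; rewrite mulrN1.
  have d3 : is_derive t 1 (fun t => phi (expR (- t))) (dphi (expR (- t)) * - expR (- t)).
    exact: (is_derive1_comp (f := phi) (g := fun t => expR (- t))).
  rewrite /chi; apply: is_derive_eq.
  rewrite /dchi /GRing.scale/=; ring.
have dchi_le0 (t : R) : 0 <= t -> dchi t <= 0.
  move=> _; set s := expR (- t).
  have s0 : 0 < s by exact: expR_gt0.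
  have E : expR (- (2 - tau) * t) = expR (tau * t) * s ^+ 2.
    by rewrite /s -expRM_natl -expRD; congr expR; ring.
  have := dotv_grad_ge (xstar + s *: u).
  rewrite (_ : xstar + s *: u - xstar = s *: u); last by rewrite addrAC subrr add0r.
  rewrite dotvZr sqnormZ -/(dphi s) -/(phi s) => H.
  rewrite /dchi -/s E.
  have -> : expR (tau * t) * (tau * phi s - s * dphi s)
      + kap * sqnorm u * (2 - tau) * (expR (tau * t) * s ^+ 2)
    = expR (tau * t) * (tau * phi s - s * dphi s
        + (kap * (2 - tau)) * (s ^+ 2 * sqnorm u)) by ring.
  rewrite kapE pmulr_rle0 ?expR_gt0//; lra.
have mono := nonincreasing_of_is_derive_le0 dchiP dchi_le0 (lexx 0).
have chi0 : chi 0 = f x - fstar - kap * sqnorm u.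
  by rewrite /chi !mulr0 oppr0 expR0 /phi scale1r /u [xstar + _]addrC subrK; ring.
(* If [chi 0 < 0], the time [t = q / - chi 0] contradicts [chi t <= chi 0]: on one side
   [chi t >= - q e^(-(2-tau)t) >= - q e^(-t)], on the other [q e^(-t) < - chi 0] because
   [t < 1 + t <= e^t]. *)
rewrite -subr_ge0 -chi0 leNgt; apply/negP => chi0_lt0.
set q := kap * sqnorm u.
have q0 : 0 <= q by rewrite mulr_ge0 ?sqnorm_ge0.
pose t := q / - chi 0.
have tt0 : 0 <= t by rewrite divr_ge0// oppr_ge0 ltW.
have := mono t tt0; apply/negP; rewrite -ltNge.
apply: (@lt_le_trans _ _ (- (q * expR (- (2 - tau) * t)))); last first.
  rewrite /chi -/q lerDr mulr_ge0 ?expR_ge0// subr_ge0 fminE; exact: fmin.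
rewrite ltrNr.
apply: (@le_lt_trans _ _ (q * expR (- t))).
  by rewrite ler_wpM2l// ler_expR; nra.
rewrite expRN -ltr_pdivlMr ?invr_gt0 ?expR_gt0// invrK.
rewrite -ltr_pdivrMl ?oppr_gt0// mulrC -/t.
by rewrite (lt_le_trans _ (expR_ge1Dx t))// ltrDr.
Qed.

End quasi_convexity.

(** * Mean of a quadratic bound in the stochastic gradient *)

Section jump.
Context {R : realType} {d : nat} {dX : measure_display} {Xi : measurableType dX}.
Variables (PXi : probability Xi R) (G : Xi -> 'rV[R]_d) (g : 'rV[R]_d) (S : R).
Hypothesis iG : forall i, PXi.-integrable setT (fun s => (G s ord0 i)%:E).
Hypothesis EG : forall i,
  (\int[PXi]_(s in setT) (G s ord0 i)%:E = (g ord0 i)%:E)%E.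
Hypothesis EG2 : (\int[PXi]_(s in setT) (sqnorm (G s))%:E <= S%:E)%E.

Lemma integrable_dotv w : PXi.-integrable setT (fun s => (dotv (G s) w)%:E).
Proof.
rewrite /dotv; under eq_fun do rewrite -sumEFin.
apply: integrable_sum => // i _.
under eq_fun do rewrite EFinM muleC.
exact: integrableZl.
Qed.

Lemma integral_dotv w :
  (\int[PXi]_(s in setT) (dotv (G s) w)%:E = (dotv g w)%:E)%E.
Proof.
rewrite /dotv; under eq_integral do rewrite -sumEFin.
rewrite integral_sum//; last first.
  move=> i; under eq_fun do rewrite EFinM muleC; exact: integrableZl.
rewrite -sumEFin; apply: eq_bigr => i _.
under eq_integral do rewrite EFinM muleC.
by rewrite integralZl// EG -EFinM mulrC.
Qed.

Lemma measurable_sqnorm : measurable_fun setT (fun s => sqnorm (G s)).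
Proof.
rewrite /sqnorm /dotv; apply: measurable_sum => i.
have /integrableP[/measurable_EFinP m _] := iG i.
exact: measurable_funM.
Qed.

Lemma integrable_sqnorm : PXi.-integrable setT (fun s => (sqnorm (G s))%:E).
Proof.
apply/integrableP; split; first exact/measurable_EFinP/measurable_sqnorm.
under eq_integral do rewrite gee0_abs ?lee_fin ?sqnorm_ge0//.
exact: le_lt_trans EG2 (ltry _).
Qed.

Lemma integral_le_quadratic (h : Xi -> R) C w K : 0 <= K ->
  measurable_fun setT h -> (forall s, 0 <= h s) ->
  (forall s, h s <= C + dotv (G s) w + K * sqnorm (G s)) ->
  (\int[PXi]_(s in setT) (h s)%:E <= (C + dotv g w + K * S)%:E)%E.
Proof.
move=> K0 mh h0 hle.
have iC : PXi.-integrable setT (fun=> C%:E).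
  apply/integrableP; split => //.
  under eq_integral do rewrite abse_EFin.
  rewrite integral_cst// [X in (_ * X)%E](_ : _ = 1%E) ?mule1 ?ltry//.
  exact: probability_setT.
have iCw : PXi.-integrable setT (fun s => C%:E + (dotv (G s) w)%:E)%E.
  by apply: integrableD => //; exact: integrable_dotv.
have iK : PXi.-integrable setT (fun s => K%:E * (sqnorm (G s))%:E)%E.
  by apply: integrableZl => //; exact: integrable_sqnorm.
apply: (@le_trans _ _ (\int[PXi]_(s in setT)
   (C%:E + (dotv (G s) w)%:E + K%:E * (sqnorm (G s))%:E))%E).
  apply: ge0_le_integral => //.
  - by move=> s _; rewrite lee_fin.
  - exact/measurable_EFinP.
  - exact: measurable_int (integrableD measurableT iCw iK).
  - by move=> s _; rewrite -EFinM -!EFinD lee_fin.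
rewrite integralD// integralD//; last exact: integrable_dotv.
rewrite integral_dotv integralZl//; last exact: integrable_sqnorm.
rewrite integral_cst// [X in (_ * X)%E](_ : _ = 1%E); last exact: probability_setT.
rewrite mule1 !EFinD EFinM leeD2l// lee_wpmul2l// lee_fin.
Qed.

End jump.

(** * One-step decrease of the Lyapunov function *)

Section descent.
Context {R : realType} {d : nat} {dX : measure_display} {Xi : measurableType dX}.
Variables (f : 'rV[R]_d -> R) (grad : 'rV[R]_d -> 'rV[R]_d).
Variables (xstar : 'rV[R]_d) (fstar L mu tau rho eps : R).
Variables (PXi : probability Xi R) (gs : 'rV[R]_d -> Xi -> 'rV[R]_d).
Hypothesis df : forall x, differentiable f x.
Hypothesis gradE : forall x h, 'd f x h = dotv (grad x) h.
Hypothesis fmin : forall x, f xstar <= f x.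
Hypothesis fminE : fstar = f xstar.
Hypotheses (L0 : 0 < L) (mu0 : 0 < mu) (tau01 : 0 < tau <= 1).
Hypothesis smooth : forall x y,
  f x - f y - dotv (grad y) (x - y) <= L / 2 * sqnorm (x - y).
Hypothesis sqc : forall x, f x + tau^-1 * dotv (grad x) (xstar - x)
  + mu / 2 * sqnorm (x - xstar) <= fstar.
Hypothesis mgs : forall i : 'I_d, measurable_fun setT
  (fun p : d.-tuple R * Xi => gs (rV_of_tuple p.1) p.2 ord0 i).
Hypothesis igs : forall x (i : 'I_d),
  PXi.-integrable setT (fun s => (gs x s ord0 i)%:E).
Hypothesis Egs : forall x (i : 'I_d),
  (\int[PXi]_(s in setT) (gs x s ord0 i)%:E = (grad x ord0 i)%:E)%E.
Hypothesis Egs2 : forall x,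
  (\int[PXi]_(s in setT) (sqnorm (gs x s))%:E <= (rho * sqnorm (grad x))%:E)%E.

(** The parameters are kept abstract, with the relations the argument runs on. [etaE], [abE] and
    [cE] cancel the coefficients of [<grad f x, z - x^*>], [<x - x^*, z - x^*>] and [|z - x^*|^2];
    [gammaE] balances the second-order cost of a jump against its first-order gain; [agamma] carries
    the lower bound on [eps]. *)
Variables (eta eta' gamma gamma' a b c : R).
Hypothesis eps01 : 0 < eps < 1.
Hypotheses (eta0 : 0 < eta) (eta'0 : 0 < eta').
Hypotheses (a0 : 0 <= a) (b0 : 0 <= b).
Hypotheses (etaE : eta = 2 * b * gamma') (abE : a * eta = b * eta').
Hypotheses (cE : c = 2 * eta') (cetaE : c = (1 - eps) * tau * eta).
Hypothesis aE : 2 * (2 - tau) * a = (1 - eps) * mu * tau.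
Hypothesis gammaE : rho * (L * gamma ^+ 2 / 2 + b * gamma' ^+ 2) = gamma.
Hypothesis agamma : 2 * a * gamma <= eps ^+ 2 * eta.

Definition lyapunov (x z : 'rV[R]_d) : R :=
  f x - fstar + b * sqnorm (z - xstar) - a * sqnorm (x - xstar).

(** By [aE], [a] is [1 - eps] times the quadratic growth constant, so the negative term takes at
    most the fraction [1 - eps] of the gap. *)
Lemma lyapunov_ge x z : eps * (f x - fstar) <= lyapunov x z.
Proof.
have /andP[e0 e1] := eps01; have /andP[t0 t1] := tau01.
have H := quadratic_growth df gradE fminE fmin mu0 tau01 sqc x.
have Z := sqnorm_ge0 (z - xstar).
have aE' : a = (1 - eps) * (tau * mu / (2 * (2 - tau))).
  have t2 : 2 - tau != 0 by rewrite gt_eqF//; lra.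
  apply: (mulfI (x := 2 * (2 - tau))); first by rewrite mulf_neq0.
  by rewrite aE; field.
have : a * sqnorm (x - xstar) <= (1 - eps) * (f x - fstar).
  by rewrite aE' -[_ * sqnorm _]mulrA; apply: ler_wpM2l => //; lra.
have := mulr_ge0 b0 Z.
by rewrite /lyapunov; lra.
Qed.

Lemma lyapunov_ge0 x z : 0 <= lyapunov x z.
Proof.
have /andP[e0 _] := eps01.
apply: le_trans (lyapunov_ge x z).
by rewrite mulr_ge0 ?subr_ge0 ?fminE// ltW.
Qed.

(** Here [p = f x - f^*], [Gu] and [Gv] are the pairings of [grad f x] with [x - x^*] and [z - x^*],
    and [U], [V], [UV] are the inner products of these two vectors. The sum is the flow derivative
    of the Lyapunov function, plus [c] times the function, plus the mean jump. After the
    cancellations only [Gu], [U] and [p] remain, and the lower bound on [Gu] absorbs the other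
    two. *)
Lemma generator_le0 (p Gu Gv U V UV : R) : 0 <= p -> 0 <= U ->
  tau * (p + mu / 2 * U) <= Gu ->
  eta * (Gv - Gu) - 2 * b * eta' * (V - UV) - 2 * a * eta * (UV - U)
  + c * (p + b * V - a * U) - 2 * b * gamma' * Gv + 2 * a * gamma * Gu <= 0.
Proof.
have et0 := eta0; have mu0' := mu0.
move=> p0 U0 GuE; have /andP[e0 e1] := eps01; have /andP[t0 t1] := tau01.
have -> : eta * (Gv - Gu) - 2 * b * eta' * (V - UV) - 2 * a * eta * (UV - U)
  + c * (p + b * V - a * U) - 2 * b * gamma' * Gv + 2 * a * gamma * Gu
  = - (eta - 2 * a * gamma) * Gu + a * (2 * eta - c) * U + c * p
    + 2 * (b * eta' - a * eta) * UV + b * (c - 2 * eta') * V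
    + (eta - 2 * b * gamma') * Gv by ring.
rewrite abE cE etaE !subrr !(mulr0, mul0r, addr0) -etaE -cE.
have eps2 : eps ^+ 2 <= eps by rewrite expr2 ler_piMl// ltW.
have D0 : (1 - eps ^+ 2) * eta <= eta - 2 * a * gamma.
  by rewrite mulrBl mul1r lerD2l lerN2.
have D1 : 0 <= eta - 2 * a * gamma.
  by apply: le_trans D0; rewrite mulr_ge0//; lra.
have K1 : c <= (eta - 2 * a * gamma) * tau.
  rewrite cetaE mulrAC ler_wpM2r ?(ltW t0)//; apply: le_trans D0.
  by rewrite ler_wpM2r ?(ltW eta0)//; lra.
(* Multiplied by [2 (2 - tau)] and divided by [(1 - eps) mu tau eta], this reduces to
   [2 - (1 - eps) tau <= (1 + eps)(2 - tau)], that is, [eps tau <= eps]. *)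
have K2 : a * (2 * eta - c) <= (eta - 2 * a * gamma) * tau * (mu / 2).
  apply: (@le_trans _ _ ((1 - eps ^+ 2) * eta * tau * (mu / 2))); last first.
    by rewrite ler_wpM2r ?ler_wpM2r//; lra.
  have t2 : 0 < 2 * (2 - tau) by lra.
  rewrite -(ler_pM2l t2) mulrA aE cetaE.
  have -> : (1 - eps) * mu * tau * (2 * eta - (1 - eps) * tau * eta)
    = ((1 - eps) * mu * tau * eta) * (2 - (1 - eps) * tau) by ring.
  have -> : 2 * (2 - tau) * ((1 - eps ^+ 2) * eta * tau * (mu / 2))
    = ((1 - eps) * mu * tau * eta) * ((1 + eps) * (2 - tau)) by field.
  apply: ler_wpM2l; first by rewrite !mulr_ge0//; lra.
  have : eps * tau <= eps by rewrite ler_piMr// ltW.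
  by lra.
have := ler_wpM2l D1 GuE.
have := ler_wpM2r U0 K2.
have := ler_wpM2r p0 K1.
by lra.
Qed.

Lemma measurable_lyapunov : measurable_fun setT
  (fun p : d.-tuple R * d.-tuple R => lyapunov (rV_of_tuple p.1) (rV_of_tuple p.2)).
Proof.
have cf : continuous f by move=> x; exact: differentiable_continuous.
apply: measurable_funB.
  apply: measurable_funD.
    apply: measurable_funB => //.
    exact: (measurableT_comp (measurable_continuous_rV_of_tuple cf)).
  apply: measurable_funM => //.
  exact: (measurableT_comp (measurable_sqnorm_rV_of_tuple_sub xstar)).
apply: measurable_funM => //.
exact: (measurableT_comp (measurable_sqnorm_rV_of_tuple_sub xstar)).
Qed.

Lemma measurable_lyapunov_jump y z : measurable_fun setT
  (fun s => lyapunov (y - gamma *: gs y s) (z - gamma' *: gs y s)).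
Proof.
have mgsy i : measurable_fun setT (fun s => gs y s ord0 i).
  by have /integrableP[/measurable_EFinP] := igs y i.
have mt u r : measurable_fun setT (fun s => tuple_of_rV (u - r *: gs y s)).
  apply: measurable_tuple_of_rV => i; under eq_fun do rewrite !mxE.
  by apply: measurable_funB => //; exact: measurable_funM.
have := measurableT_comp measurable_lyapunov
  (measurable_fun_pair (mt y gamma) (mt z gamma')).
by rewrite /comp/=; under eq_fun do rewrite !tuple_of_rVK.
Qed.

(** Smoothness bounds the [f] part and the squared norms expand exactly, so the integrand is at most
    quadratic in the sampled gradient; its term [- a gamma^2 |g|^2] is dropped. In the mean,
    [gammaE] makes the growth bound [K rho |grad f y|^2] cancel [- gamma |grad f y|^2]. *)
Lemma integral_lyapunov_jump_le y z :
  (\int[PXi]_(s in setT)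
      (lyapunov (y - gamma *: gs y s) (z - gamma' *: gs y s))%:E
   <= (lyapunov y z - 2 * b * gamma' * dotv (grad y) (z - xstar)
       + 2 * a * gamma * dotv (grad y) (y - xstar))%:E)%E.
Proof.
(* [K] is the coefficient of the squared norm of the sampled gradient, and [w] gathers all that is
   paired with it linearly. *)
set K := L * gamma ^+ 2 / 2 + b * gamma' ^+ 2.
set w := - gamma *: grad y - (2 * b * gamma') *: (z - xstar)
  + (2 * a * gamma) *: (y - xstar).
have K0 : 0 <= K.
  apply: addr_ge0; last by rewrite mulr_ge0 ?sqr_ge0.
  by rewrite divr_ge0// mulr_ge0 ?sqr_ge0// ltW.
apply: le_trans (@integral_le_quadratic _ _ _ _ PXi (gs y) (grad y)
  (rho * sqnorm (grad y)) (igs y) (Egs y) (Egs2 y) _ (lyapunov y z) w K K0 _ _ _) _.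
- exact: measurable_lyapunov_jump.
- by move=> s; exact: lyapunov_ge0.
- move=> s; have := smooth (y - gamma *: gs y s) y.
  have -> : y - gamma *: gs y s - y = - (gamma *: gs y s).
    by rewrite addrAC subrr add0r.
  rewrite sqnormN sqnormZ dotvNr dotvZr => sm.
  rewrite /lyapunov [z - _ - xstar]addrAC [y - _ - xstar]addrAC.
  rewrite ![sqnorm (_ - xstar - _)]sqnormB !sqnormZ !dotvZr.
  rewrite /w !dotvDr !dotvZr dotvNr dotvZr /K.
  rewrite ![dotv (gs y s) _]dotvC.
  have Q := mulr_ge0 (mulr_ge0 a0 (sqr_ge0 gamma)) (sqnorm_ge0 (gs y s)).
  by lra.
- rewrite lee_fin /w !(dotvDr, dotvZr, dotvNr) -/(sqnorm (grad y)).
  have -> : K * (rho * sqnorm (grad y)) = gamma * sqnorm (grad y).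
    by rewrite -[in RHS]gammaE /K; ring.
  by rewrite le_eqVlt; apply/orP; left; apply/eqP; ring.
Qed.

(** Closed-form solution at time [t] of [x' = eta (z - x)], [z' = eta' (x - z)], in which [z - x]
    decays at rate [eta + eta']. *)
Definition flow (p : 'rV[R]_d * 'rV[R]_d) (t : R) : 'rV[R]_d * 'rV[R]_d :=
  let e := expR (- (eta + eta') * t) in
  (p.1 + (eta / (eta + eta') * (1 - e)) *: (p.2 - p.1),
   p.2 - (eta' / (eta + eta') * (1 - e)) *: (p.2 - p.1)).

Definition jump (p : 'rV[R]_d * 'rV[R]_d) (s : Xi) : 'rV[R]_d * 'rV[R]_d :=
  (p.1 - gamma *: gs p.1 s, p.2 - gamma' *: gs p.1 s).

Lemma flow_gap p t : (flow p t).2 - (flow p t).1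
  = expR (- (eta + eta') * t) *: (p.2 - p.1).
Proof.
have k0 : eta + eta' != 0 by rewrite gt_eqF// addr_gt0.
apply/rowP => i; rewrite !mxE; field.
exact: k0.
Qed.

Lemma is_derive_lyapunov_flow p (t : R) :
  is_derive t 1 (fun t => lyapunov (flow p t).1 (flow p t).2)
    (let x := (flow p t).1 in let z := (flow p t).2 in
     eta * (dotv (grad x) (z - xstar) - dotv (grad x) (x - xstar))
     - 2 * b * eta' * (sqnorm (z - xstar) - dotv (x - xstar) (z - xstar))
     - 2 * a * eta * (dotv (x - xstar) (z - xstar) - sqnorm (x - xstar))).
Proof.
case: p => x z; set e := fun t => expR (- (eta + eta') * t).
have k0 : eta + eta' != 0 by rewrite gt_eqF// addr_gt0.
(* Packing the vectors existentially makes the names opaque, so that they stay atoms under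
   rewriting. *)
have [w wE] : exists w, w = z - x by exists (z - x).
have [u uE] : exists u, u = x - xstar by exists (x - xstar).
have [v vE] : exists v, v = z - xstar by exists (z - xstar).
pose s t := eta / (eta + eta') * (1 - e t).
pose r t := - (eta' / (eta + eta') * (1 - e t)).
have de : is_derive t 1 e (- (eta + eta') * e t).
  rewrite /e; apply: is_derive_eq; rewrite /GRing.scale/=; ring.
have ds : is_derive t 1 s (eta * e t).
  rewrite /s; apply: is_derive_eq; rewrite /GRing.scale/=; field; exact: k0.
have dr : is_derive t 1 r (- (eta' * e t)).
  rewrite /r; apply: is_derive_eq; rewrite /GRing.scale/=; field; exact: k0.
have dphi := is_derive_line df gradE x w (s t).
have dfs : is_derive t 1 (fun t => f (x + s t *: w))
    (dotv (grad (x + s t *: w)) w * (eta * e t)).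
  exact: (is_derive1_comp (f := fun s => f (x + s *: w)) (g := s)).
(* Along the flow both squared norms are quadratic polynomials in the scalars [s t] and [r t], so
   only scalar derivatives and one directional derivative of [f] are left. *)
have WE : (fun t => lyapunov (flow (x, z) t).1 (flow (x, z) t).2)
  = (fun t => f (x + s t *: w) - fstar
      + b * (sqnorm v + 2 * dotv v w * r t + sqnorm w * (r t * r t))
      - a * (sqnorm u + 2 * dotv u w * s t + sqnorm w * (s t * s t))).
  apply/funext => t'; rewrite /lyapunov /flow/= -/(e t') -/(s t') -wE -scaleNr -/(r t').
  rewrite [z + _ - _]addrAC [x + _ - _]addrAC -uE -vE !sqnormD !sqnormZ !dotvZr.
  by congr (_ - _ + _ * _ - _ * _); ring.
rewrite WE; apply: is_derive_eq.
have E : (flow (x, z) t).2 - (flow (x, z) t).1 = e t *: w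
  by rewrite flow_gap wE.
have E1 : (flow (x, z) t).1 = x + s t *: w by rewrite wE.
have E2 : (flow (x, z) t).2 = z + r t *: w by rewrite wE /= -scaleNr.
rewrite E1 E2 /=.
have -> : dotv (grad (x + s t *: w)) (z + r t *: w - xstar)
    - dotv (grad (x + s t *: w)) (x + s t *: w - xstar)
  = e t * dotv (grad (x + s t *: w)) w.
  rewrite -dotvNr -dotvDr -dotvZr -E E1 E2; congr dotv.
  by rewrite opprB addrA subrK.
rewrite [z + _ - _]addrAC [x + _ - xstar]addrAC -uE -vE.
have vu : v = u + w by rewrite vE uE wE [RHS]addrC addrA subrK.
have er : 1 + r t - s t = e t.
  rewrite /r /s; field; exact: k0.
rewrite vu !sqnormD !dotvE !sqnormZ -!/(sqnorm _) [dotv w u]dotvC.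
rewrite /GRing.scale/= -er.
ring.
Qed.

(** The chain runs on an arrival time and two tuples, since tuples carry the product sigma-algebra;
    [state_dec] and [state_enc] translate to row vectors, where the algebra is done. *)
Definition state_dec (m : d.-tuple R * d.-tuple R) : 'rV[R]_d * 'rV[R]_d :=
  (rV_of_tuple m.1, rV_of_tuple m.2).

Definition state_enc (p : 'rV[R]_d * 'rV[R]_d) : d.-tuple R * d.-tuple R :=
  (tuple_of_rV p.1, tuple_of_rV p.2).

Lemma state_encK p : state_dec (state_enc p) = p.
Proof. by case: p => x z; rewrite /state_dec /= !tuple_of_rVK. Qed.

Local Notation state := (R * (d.-tuple R * d.-tuple R))%type.

Definition flow_state (q : state * R) : state :=
  (q.1.1 + q.2, state_enc (flow (state_dec q.1.2) q.2)).

Definition jump_state (q : state * Xi) : state :=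
  (q.1.1, state_enc (jump (state_dec q.1.2) q.2)).

Definition potential (m : state) : \bar R :=
  (expR (c * m.1) * lyapunov (state_dec m.2).1 (state_dec m.2).2)%:E.

Lemma measurable_flow_state : measurable_fun setT flow_state.
Proof.
have m1 i : measurable_fun setT (fun q : state * R => tnth q.1.2.1 i).
  apply: (measurableT_comp (measurable_tnth i)).
  exact: (measurableT_comp measurable_fst (measurableT_comp measurable_snd measurable_fst)).
have m2 i : measurable_fun setT (fun q : state * R => tnth q.1.2.2 i).
  apply: (measurableT_comp (measurable_tnth i)).
  exact: (measurableT_comp measurable_snd (measurableT_comp measurable_snd measurable_fst)).
have me k : measurable_fun setT
    (fun q : state * R => k * (1 - expR (- (eta + eta') * q.2))).
  apply: measurable_funM => //; apply: measurable_funB => //.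
  apply: (measurableT_comp (@measurable_expR R)).
  exact: measurable_funM.
apply: measurable_fun_pair.
  apply: measurable_funD => //.
  exact: (measurableT_comp measurable_fst measurable_fst).
apply: measurable_fun_pair; apply: measurable_tuple_of_rV => i;
  under eq_fun do rewrite !mxE.
- by apply: measurable_funD => //; apply: measurable_funM => //; exact: measurable_funB.
- by apply: measurable_funB => //; apply: measurable_funM => //; exact: measurable_funB.
Qed.

Lemma measurable_jump_state : measurable_fun setT jump_state.
Proof.
have m1 i : measurable_fun setT (fun q : state * Xi => tnth q.1.2.1 i).
  apply: (measurableT_comp (measurable_tnth i)).
  exact: (measurableT_comp measurable_fst (measurableT_comp measurable_snd measurable_fst)).
have m2 i : measurable_fun setT (fun q : state * Xi => tnth q.1.2.2 i).
  apply: (measurableT_comp (measurable_tnth i)).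
  exact: (measurableT_comp measurable_snd (measurableT_comp measurable_snd measurable_fst)).
have mg i : measurable_fun setT
    (fun q : state * Xi => gs (rV_of_tuple q.1.2.1) q.2 ord0 i).
  apply: (measurableT_comp (mgs i) (g := fun q : state * Xi => (q.1.2.1, q.2))).
  apply: measurable_fun_pair => //.
  exact: (measurableT_comp measurable_fst (measurableT_comp measurable_snd measurable_fst)).
apply: measurable_fun_pair.
  exact: (measurableT_comp measurable_fst measurable_fst).
apply: measurable_fun_pair; apply: measurable_tuple_of_rV => i;
  under eq_fun do rewrite !mxE;
  by apply: measurable_funB => //; exact: measurable_funM.
Qed.

Lemma measurable_potential : measurable_fun setT potential.
Proof.
apply/measurable_EFinP; apply: measurable_funM.
  apply: (measurableT_comp (@measurable_expR R)).
  by apply: measurable_funM.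
exact: (measurableT_comp measurable_lyapunov).
Qed.

Lemma potential_ge0 m : (0 <= potential m)%E.
Proof. by rewrite lee_fin mulr_ge0 ?expR_ge0// lyapunov_ge0. Qed.

Lemma potential_jump_flow T m t s :
  potential (jump_state (flow_state ((T, m), t), s))
  = (expR (c * (T + t)) * lyapunov (jump (flow (state_dec m) t) s).1
                                   (jump (flow (state_dec m) t) s).2)%:E.
Proof.
rewrite /potential /jump_state /flow_state.
by cbn beta iota delta [fst snd]; rewrite !state_encK.
Qed.

(** The exponential density turns the weight [e^(c (T + t))] into [e^(cT + (c-1)t)]. With [F] this
    weight times the Lyapunov function along the flow, the integrand is at most [- F'], so the
    integral is at most [F 0], the initial potential. *)
Lemma expectation_potential_step_le (nu : probability R R) :
  (forall A : set R, measurable A -> nu A = exponential_prob 1 A) ->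
  forall m, (\int[nu]_(t in setT) \int[PXi]_(s in setT)
    potential (jump_state (flow_state (m, t), s)) <= potential m)%E.
Proof.
move=> nuE m; case: m => T m; set p := state_dec m.
pose H n := (\int[PXi]_(s in setT) potential (jump_state (n, s)))%E.
have mpj : measurable_fun setT (fun q => potential (jump_state q)).
  exact: measurableT_comp measurable_potential measurable_jump_state.
have mH : measurable_fun setT H.
  apply: (measurable_fun_fubini_tonelli_F (fun q => potential (jump_state q))) => //.
  by move=> q; exact: potential_ge0.
have mHt : measurable_fun setT (fun t => H (flow_state ((T, m), t))).
  apply: (measurableT_comp mH); apply: (measurableT_comp measurable_flow_state).
  exact: measurable_fun_pair.
have H0 n : (0 <= H n)%E by apply: integral_ge0 => s _; exact: potential_ge0.
change (\int[nu]_(t in setT) H (flow_state ((T, m), t)) <= potential (T, m))%E.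
have mid : @measurable_fun _ _ R (measurableTypeR R) setT idfun by exact: measurable_id.
(* Lebesgue measure lives on [measurableTypeR R], whose display differs from
   that of [R], so [nu] is transported along the identity. *)
pose idm : {mfun R >-> measurableTypeR R} :=
  HB.pack (idfun : R -> measurableTypeR R) (isMeasurableFun.Build _ _ _ _ _ mid).
have -> : (\int[nu]_(t in setT) H (flow_state ((T, m), t))
  = \int[distribution nu idm]_(t in setT) H (flow_state ((T, m), t)))%E.
  by rewrite ge0_integral_distribution.
rewrite (@integral_density _ (measurableTypeR R) R (distribution nu idm)
  lebesgue_measure (exponential_pdf 1))//; last exact: measurable_exponential_pdf.
pose e (t : R) := expR (c * T + (c - 1) * t).
pose W t := lyapunov (flow p t).1 (flow p t).2.
pose u t := (flow p t).1 - xstar; pose v t := (flow p t).2 - xstar.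
pose g t := grad (flow p t).1.
pose W' t := eta * (dotv (g t) (v t) - dotv (g t) (u t))
  - 2 * b * eta' * (sqnorm (v t) - dotv (u t) (v t))
  - 2 * a * eta * (dotv (u t) (v t) - sqnorm (u t)).
have dW (t : R) : is_derive t 1 W (W' t) by exact: is_derive_lyapunov_flow.
pose F t := e t * W t; pose F' t := e t * ((c - 1) * W t + W' t).
have dF (t : R) : is_derive t 1 F (F' t).
  have de : is_derive t 1 e ((c - 1) * e t).
    rewrite /e; apply: is_derive_eq; rewrite /GRing.scale/=; ring.
  apply: is_derive_eq; rewrite /F' /GRing.scale/=; ring.
(* The mean after the jump is bounded by [W t] plus the jump terms, so after division by [e t] the
   claim is [generator_le0]. *)
have HF' t : (H (flow_state ((T, m), t)) * (expR (- t))%:E <= (- F' t)%:E)%E.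
  have -> : H (flow_state ((T, m), t)) = ((expR (c * (T + t)))%:E *
      \int[PXi]_(s in setT) (lyapunov (jump (flow p t) s).1 (jump (flow p t) s).2)%:E)%E.
    rewrite -ge0_integralZl_EFin ?expR_ge0//.
    - by apply: eq_integral => s _; rewrite potential_jump_flow -EFinM.
    - by move=> s _; rewrite lee_fin lyapunov_ge0.
    - by apply/measurable_EFinP; exact: measurable_lyapunov_jump.
  rewrite muleC muleA -EFinM -expRD.
  have -> : - t + c * (T + t) = c * T + (c - 1) * t by ring.
  apply: le_trans (lee_wpmul2l _ (integral_lyapunov_jump_le _ _)) _.
    by rewrite lee_fin expR_ge0.
  rewrite -EFinM lee_fin /F' -[- (e t * _)]mulrN.
  apply: ler_wpM2l; first exact: expR_ge0.
  have := @generator_le0 (f (flow p t).1 - fstar) (dotv (g t) (u t))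
    (dotv (g t) (v t)) (sqnorm (u t)) (sqnorm (v t)) (dotv (u t) (v t)) _
    (sqnorm_ge0 _) (dotv_grad_ge tau01 sqc _).
  rewrite -/(u t) -/(v t) -/(g t) subr_ge0 fminE => /(_ (fmin _)).
  have WE : W t = f (flow p t).1 - f xstar + b * sqnorm (v t) - a * sqnorm (u t).
    by rewrite -fminE.
  rewrite -/(W t) -/(g t) -/(u t) -/(v t) WE /W'; lra.
have F'_le0 t : F' t <= 0.
  by rewrite -oppr_ge0 -lee_fin (le_trans _ (HF' t))// mule_ge0// lee_fin expR_ge0.
have -> : (\int[lebesgue_measure]_(t in setT)
     (H (flow_state ((T, m), t)) * (exponential_pdf 1 t)%:E)
   = \int[lebesgue_measure]_(t in `[0%R, +oo[)
     (H (flow_state ((T, m), t)) * (expR (- t))%:E))%E.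
  rewrite [RHS]integral_mkcond; apply: eq_integral => t _.
  rewrite /exponential_pdf !patchE; case: ifPn => _; last by rewrite mule0.
  by rewrite mul1r mulN1r.
have -> : potential (T, m) = (F 0)%:E.
  rewrite /potential /F /e /W /= mulr0 addr0 /flow !mulr0 expR0 subrr !mulr0 !scale0r.
  by rewrite addr0 subr0.
apply: (integral_le_of_is_derive dF) => //.
- by move=> t t0; rewrite mulr_ge0 ?expR_ge0// lyapunov_ge0.
- apply: emeasurable_funM => //; apply/measurable_EFinP.
  exact: measurableT_comp.
- by move=> t; rewrite mule_ge0// lee_fin expR_ge0.
Qed.

(** * From one step to the expected gap of the iterates *)

Section convergence.
Context {dO : measure_display} {Om : measurableType dO} (P : probability Om R).
Variables (Delta : nat -> Om -> R) (xi : nat -> Om -> Xi) (x0 : 'rV[R]_d).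
Hypothesis mDelta : forall n, measurable_fun setT (Delta n).
Hypothesis mxi : forall n, measurable_fun setT (xi n).
Hypothesis lawDelta : forall n (A : set R), measurable A ->
  P (Delta n @^-1` A) = exponential_prob 1 A.
Hypothesis lawxi : forall n (B : set Xi), measurable B ->
  P (xi n @^-1` B) = PXi B.
Hypothesis indep : mutually_independent P Delta xi.

Let iter k w := cn_iter eta eta' gamma gamma' gs x0
  (fun n => Delta n w) (fun n => xi n w) k.

(** The algorithm moves [z] along [y - z], the flow along [x - z]. They agree because [y - z = (eta'
    + eta e) / (eta + eta') (x - z)], which cancels the denominator of the algorithm's
    coefficient. *)
Lemma cn_iterS k w :
  iter k.+1 w = jump (flow (iter k w) (Delta k w)) (xi k w).
Proof.
rewrite /iter /=; case: (cn_iter _ _ _ _ _ _ _ _ k) => x z.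
rewrite /jump /flow /=; set e := expR _; congr (_, _ - _).
have e0 : 0 < e by exact: expR_gt0.
have k0 : eta + eta' != 0 by rewrite gt_eqF// addr_gt0.
have ke0 : eta' + eta * e != 0 by rewrite gt_eqF// addr_gt0// mulr_gt0.
apply/rowP => i; rewrite !mxE; field.
by rewrite k0 ke0.
Qed.

Let X k w : state := (arrival (fun n => Delta n w) k, state_enc (iter k w)).

(** The chain bound applies to the potential, and [lyapunov_ge] converts it to the gap at the cost
    of the factor [1/eps]. *)
Lemma expectation_gap_le k :
  (\int[P]_(w in setT)
     (expR (c * arrival (fun n => Delta n w) k) * (f (iter k w).1 - fstar))%:E
   <= (eps^-1 * lyapunov x0 x0)%:E)%E.
Proof.
have /andP[e0 _] := eps01.
have X0 : X 0 = cst (0, state_enc (x0, x0)).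
  by apply/funext => w; rewrite /X /arrival big_ord0.
have XS n w : X n.+1 w = jump_state (flow_state (X n w, Delta n w), xi n w).
  rewrite /X cn_iterS /arrival big_ord_recr /jump_state /flow_state.
  by cbn beta iota delta [fst snd]; rewrite !state_encK.
have mX := measurable_chain mDelta mxi measurable_flow_state
  measurable_jump_state X0 XS k.
pose nu := distribution P
  (HB.pack (Delta 0) (isMeasurableFun.Build _ _ _ _ _ (mDelta 0)) : {mfun Om >-> R}).
have nuE (A : set R) : measurable A -> nu A = exponential_prob 1 A.
  exact: lawDelta.
have chain := expectation_chain_le mDelta mxi indep (nu := nu) (PXi := PXi)
  (fun n A mA => etrans (lawDelta n mA) (esym (nuE A mA))) lawxi
  measurable_flow_state measurable_jump_state X0 XS
  measurable_potential potential_ge0 (expectation_potential_step_le nuE) k.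
have potX w : potential (X k w)
  = (expR (c * arrival (fun n => Delta n w) k) * lyapunov (iter k w).1 (iter k w).2)%:E.
  by rewrite /potential /X; cbn beta iota delta [fst snd]; rewrite state_encK.
have pot0 : potential (0, state_enc (x0, x0)) = (lyapunov x0 x0)%:E.
  by rewrite /potential; cbn beta iota delta [fst snd];
    rewrite state_encK mulr0 expR0 mul1r.
have mpX : measurable_fun setT (fun w => potential (X k w)).
  exact: measurableT_comp measurable_potential mX.
have mf : measurable_fun setT (fun w => f (iter k w).1 - fstar).
  have cf : continuous f by move=> x; exact: differentiable_continuous.
  apply: measurable_funB => //.
  have := measurableT_comp (measurable_continuous_rV_of_tuple cf)
    (measurableT_comp measurable_fst (measurableT_comp measurable_snd mX)).
  by rewrite /comp /X /state_enc /=; under eq_fun do rewrite tuple_of_rVK.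
have mA : measurable_fun setT (fun w => arrival (fun n => Delta n w) k).
  exact: measurableT_comp measurable_fst mX.
apply: (@le_trans _ _ (\int[P]_(w in setT) ((eps^-1)%:E * potential (X k w)))%E).
  apply: ge0_le_integral => //.
  - by move=> w _; rewrite lee_fin mulr_ge0 ?expR_ge0// subr_ge0 fminE.
  - apply/measurable_EFinP; apply: measurable_funM => //.
    by apply: measurableT_comp => //; exact: measurable_funM.
  - exact: measurable_funeM.
  - move=> w _; rewrite potX -EFinM lee_fin mulrCA.
    apply: ler_wpM2l; first exact: expR_ge0.
    by rewrite ler_pdivlMl// lyapunov_ge.
rewrite ge0_integralZl_EFin//; last 2 first.
- by move=> w _; exact: potential_ge0.
- by rewrite invr_ge0 ltW.
rewrite EFinM -pot0 lee_wpmul2l// lee_fin invr_ge0 ltW//.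
Qed.

End convergence.

End descent.

(** * Checking the parameter relations *)

Unset Implicit Arguments.

Theorem theorem5
  (R : realType) (d : nat)
  (f : 'rV[R]_d -> R) (grad : 'rV[R]_d -> 'rV[R]_d)
  (xstar : 'rV[R]_d) (fstar : R)
  (L mu tau rho eps : R)
  (dX : measure_display) (Xi : measurableType dX) (PXi : probability Xi R)
  (gs : 'rV[R]_d -> Xi -> 'rV[R]_d)
  (dO : measure_display) (Om : measurableType dO) (P : probability Om R)
  (Delta : nat -> Om -> R) (xi : nat -> Om -> Xi)
  (x0 : 'rV[R]_d) (k : nat) :
  (* f differentiable, with gradient grad *)
  (forall x, differentiable f x) ->
  (forall x h, 'd f x h = dotv (grad x) h) ->
  (* f^* is the minimum value of f, attained at xstar *)
  (forall x, f xstar <= f x) -> fstar = f xstar ->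
  0 < L -> 0 < mu -> 0 < tau <= 1 -> 1 <= rho ->
  (* L-smoothness *)
  (forall x y, f x - f y - dotv (grad y) (x - y) <= L / 2 * sqnorm (x - y)) ->
  (* strong quasi-convexity w.r.t. the minimizer xstar *)
  (forall x, f x + tau^-1 * dotv (grad x) (xstar - x)
             + mu / 2 * sqnorm (x - xstar) <= fstar) ->
  (* the stochastic gradient oracle is (jointly) measurable *)
  (forall i : 'I_d,
     measurable_fun setT (fun p : d.-tuple R * Xi => gs (rV_of_tuple p.1) p.2 ord0 i)) ->
  (* strong growth condition (unbiased, bounded second moment) *)
  (forall x (i : 'I_d), PXi.-integrable setT (fun s => (gs x s ord0 i)%:E)) ->
  (forall x (i : 'I_d), (\int[PXi]_(s in setT) (gs x s ord0 i)%:E = (grad x ord0 i)%:E)%E) ->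
  (forall x, (\int[PXi]_(s in setT) (sqnorm (gs x s))%:E <= (rho * sqnorm (grad x))%:E)%E) ->
  (* random inputs: Delta_k i.i.d. Exp(1), xi_{k+1} i.i.d. with law PXi,
     all mutually independent *)
  (forall n, measurable_fun setT (Delta n)) ->
  (forall n, measurable_fun setT (xi n)) ->
  (forall n (A : set R), measurable A -> P (Delta n @^-1` A) = exponential_prob 1 A) ->
  (forall n (B : set Xi), measurable B -> P (xi n @^-1` B) = PXi B) ->
  mutually_independent P Delta xi ->
  (* accuracy parameter *)
  0 < eps < 1 -> (mu / L) `^ (4%:R^-1) <= eps ->
  let eta' := (1 - eps) * tau / rho * Num.sqrt (2 * (2 - tau))^-1 * Num.sqrt (mu / L) in
  let eta := rho^-1 * Num.sqrt (2 / (2 - tau)) * Num.sqrt (mu / L) in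
  let gamma' := rho^-1 * Num.sqrt ((2 - tau) / (2 * mu * L)) in
  let gamma := (rho * L)^-1 in
  let c := (1 - eps) * tau / rho * Num.sqrt (2 / (2 - tau)) * Num.sqrt (mu / L) in
  (\int[P]_(w in setT)
      (expR (c * arrival (fun n => Delta n w) k)
       * (f (cn_iter eta eta' gamma gamma' gs x0
               (fun n => Delta n w) (fun n => xi n w) k).1 - fstar))%:E
   <= (eps^-1 * (f x0 - fstar + mu * sqnorm (x0 - xstar)))%:E)%E.

Proof.
move=> df gradE fmin fminE L0 mu0 tau01 rho1 smooth sqc mgs igs Egs Egs2 mD mxi
  lawD lawxi indep eps01 epsE.
cbv zeta.
pose B := Num.sqrt (2 * (2 - tau))^-1.
pose A := Num.sqrt (2 / (2 - tau)).
pose q := Num.sqrt (mu / L).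
pose S := Num.sqrt ((2 - tau) / (2 * mu * L)).
pose eta' := (1 - eps) * tau / rho * B * q.
pose eta := rho^-1 * A * q.
pose gamma' := rho^-1 * S.
pose gamma := (rho * L)^-1.
pose c := (1 - eps) * tau / rho * A * q.
have /andP[t0 t1] := tau01; have /andP[e0 e1] := eps01.
have r0 : 0 < rho by exact: lt_le_trans rho1.
have t2 : 0 < 2 - tau by lra.
(* The weights of the Lyapunov function. *)
pose b := mu / (2 - tau).
pose a := (1 - eps) * mu * tau / (2 * (2 - tau)).
have q0 : 0 < q by rewrite sqrtr_gt0 divr_gt0.
have A0 : 0 < A by rewrite sqrtr_gt0 divr_gt0.
have S0 : 0 < S by rewrite sqrtr_gt0 divr_gt0 ?mulr_gt0.
have qq : q ^+ 2 = mu / L by rewrite sqr_sqrtr// divr_ge0 ?ltW.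
have AA : A ^+ 2 = 2 / (2 - tau) by rewrite sqr_sqrtr// divr_ge0 ?ltW.
have SS : S ^+ 2 = (2 - tau) / (2 * mu * L).
  by rewrite sqr_sqrtr// divr_ge0// ?mulr_ge0// ltW.
have AB : A = 2 * B.
  rewrite /A /B (_ : 2 / (2 - tau) = 2 ^+ 2 * (2 * (2 - tau))^-1); last first.
    by field; rewrite gt_eqF.
  by rewrite sqrtrM ?exprn_ge0// sqrtr_sqr ger0_norm.
have B0 : 0 < B by move: A0; rewrite AB pmulr_rgt0.
have b0 : 0 < b by rewrite divr_gt0.
(* Both sides are nonnegative and have the square [2 mu / ((2 - tau) L)]. *)
have AqS : A * q = 2 * b * S.
  have Aq0 : 0 <= A * q by rewrite mulr_ge0 ?(ltW A0) ?(ltW q0).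
  have bS0 : 0 <= 2 * b * S by rewrite mulr_ge0 ?(ltW S0)// mulr_ge0// ltW.
  apply/eqP; rewrite -(@eqrXn2 _ 2)//.
  rewrite !exprMn AA qq SS /b; apply/eqP; field.
  by rewrite !gt_eqF.
have A1 : 1 <= A.
  have h : 1 <= 2 / (2 - tau) by rewrite ler_pdivlMr// mul1r; lra.
  by rewrite -[leLHS]sqrtr1 ler_sqrt// (le_trans _ h).
(* The square of the hypothesis [(mu / L)^(1/4) <= eps]. *)
have eps2 : q <= eps ^+ 2.
  rewrite /q -powR12_sqrt; last by rewrite divr_ge0 ?ltW.
  have -> : (2 : R)^-1 = 4^-1 * 2%:R by field.
  rewrite powRrM powR_mulrn ?powR_ge0//.
  by rewrite lerXn2r ?nnegrE ?powR_ge0// ltW.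
have a0 : 0 <= a.
  apply: divr_ge0; last by rewrite mulr_ge0// ltW.
  by rewrite !mulr_ge0 ?subr_ge0//; exact: ltW.
have eta0 : 0 < eta by rewrite /eta !mulr_gt0 ?invr_gt0.
have eta'0 : 0 < eta' by rewrite /eta' !mulr_gt0 ?invr_gt0 ?subr_gt0.
have etaE : eta = 2 * b * gamma'.
  by rewrite /eta /gamma' -mulrA AqS; ring.
have abE : a * eta = b * eta'.
  rewrite /a /b /eta /eta' AB; field; by rewrite !gt_eqF.
have cE : c = 2 * eta' by rewrite /c /eta' AB; ring.
have cetaE : c = (1 - eps) * tau * eta by rewrite /c /eta; ring.
have aE : 2 * (2 - tau) * a = (1 - eps) * mu * tau.
  by rewrite /a; field; rewrite gt_eqF.
have gammaE : rho * (L * gamma ^+ 2 / 2 + b * gamma' ^+ 2) = gamma.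
  rewrite /gamma /gamma' exprMn SS /b; field.
  by rewrite !gt_eqF.
(* The factor [(1 - eps) tau / (2 - tau)] is at most 1, hence at most [A], and one of the two
   factors [q] in [mu / L = q^2] is at most [eps^2]. *)
have agamma : 2 * a * gamma <= eps ^+ 2 * eta.
  have -> : 2 * a * gamma = rho^-1 * (mu / L) * ((1 - eps) * tau / (2 - tau)).
    by rewrite /a /gamma; field; rewrite !gt_eqF.
  apply: (@le_trans _ _ (rho^-1 * (mu / L) * A)).
    apply: ler_wpM2l; first by rewrite mulr_ge0 ?divr_ge0 ?invr_ge0// ltW.
    apply: le_trans A1; rewrite ler_pdivrMr// mul1r.
    have : 0 <= eps * tau by rewrite mulr_ge0// ltW.
    lra.
  have -> : eps ^+ 2 * eta = rho^-1 * (eps ^+ 2 * q) * A by rewrite /eta; ring.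
  apply: ler_wpM2r; first exact: ltW.
  apply: ler_wpM2l; first by rewrite invr_ge0 ltW.
  by rewrite -qq expr2 ler_wpM2r// ltW.
have gap := (expectation_gap_le df gradE fmin fminE L0 mu0 tau01 smooth sqc
  mgs igs Egs Egs2 eps01 eta0 eta'0 a0 (ltW b0) etaE abE cE cetaE aE
  gammaE agamma x0 mD mxi lawD lawxi indep k).
apply: (le_trans gap).
(* At the start [x = z = x0]: the term in [a] is dropped, and [b <= mu] since [2 - tau >= 1]. *)
rewrite lee_fin; apply: ler_wpM2l; first by rewrite invr_ge0 ltW.
have sq := sqnorm_ge0 (x0 - xstar).
have bmu : b <= mu.
  have t21 : 1 <= 2 - tau by lra.
  by rewrite ler_pdivrMr// -[leLHS]mulr1 ler_wpM2l// ltW.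
have := ler_wpM2r sq bmu; have := mulr_ge0 a0 sq.
rewrite /lyapunov; lra.
Qed.
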